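(* Let $k$ be a perfect field, let $\Gamma\subset\mathbb{P}^r_k$ be an integral non-degenerate projective curve, let $C=\Gamma\cap\{X_0\neq 0\}\subset\mathbb{A}^r_k$ be its affine part with coordinate ring $k[C]$, and let $P\in\operatorname{Sing}(C)$. Let $\frac1d U$ be the minimal local contribution to the normalization $\overline{k[C]}$ at $P$, where $U\subset k[C]$ is an ideal and $0\neq d\in U$. Then for every point $Q\in C$, $$(\langle d\rangle_{k[C]}:U)_Q=\begin{cases}\mathcal{C}_{\mathcal{O}_{C,Q}} & \text{if } Q=P,\\ \mathcal{O}_{C,Q} & \text{if } Q\neq P.\end{cases}$$
   Context: Points are closed points. $\operatorname{Sing}(C)$ is the set of singular points of $C$. For a reduced Noetherian ring $A$ with normalization $\overline{A}$ (integral closure in its total ring of fractions), the conductor is $\mathcal{C}_A=\{a\in A\mid a\overline{A}\subset A\}$. Let $A=k[C]$ and $\operatorname{Sing}(C)=\{P_1,\dots,P_s\}$. A local contribution to $\overline{A}$ at $P_i$ is an intermediate ring $A\subset A^{(i)}\subset\overline{A}$ with $A^{(i)}_{P_i}=\overline{A_{P_i}}$ (the subscript denoting localization at the prime of $A$ corresponding to the point). It is the minimal local contribution if in addition $A^{(i)}_{P_j}=A_{P_j}$ for all $j\neq i$; it is then uniquely determined. It is written as a fractional ideal $\frac1dU=\{u/d\mid u\in U\}\subset \mathrm{Q}(A)$, where $\mathrm{Q}(A)$ is the quotient field of $A$. The ideal quotient is $\langle d\rangle_{k[C]}:U=\{s\in k[C]\mid sU\subset\langle d\rangle\}$, and the subscript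 $Q$ denotes localization at $Q$. *)

(* Defs.v *)
From HB Require Import structures.
From mathcomp Require Import all_boot all_algebra.
From mathcomp Require Import separable mpoly.
From mathcomp Require Import boolp classical_sets.

Set Implicit Arguments.
Unset Strict Implicit.
Unset Printing Implicit Defensive.

Import GRing.Theory.

Local Open Scope classical_set_scope.
Local Open Scope ring_scope.

Definition perfect_field (k : fieldType) : Prop :=
  forall p : {poly k}, irreducible_poly p -> separable_poly p.

(* Rings are given as subsets R of an ambient commutative ring, so that the  *)
(* same notions apply to a whole type (R = setT) and to local rings inside a *)
(* field of fractions.                                                       *)
Section SubringTheory.
Variable T : comNzRingType.
Implicit Types R I J m : set T.

Definition subring R : Prop :=
  [/\ R 1, forall x y, R x -> R y -> R (x - y)
    & forall x y, R x -> R y -> R (x * y)].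

(* The unit ideal R itself is allowed. *)
Definition is_ideal R I : Prop :=
  [/\ I `<=` R, I 0, forall x y, I x -> I y -> I (x + y)
    & forall a x, R a -> I x -> I (a * x)].

Definition prime_ideal R I : Prop :=
  [/\ is_ideal R I, ~ I 1
    & forall a b, R a -> R b -> I (a * b) -> I a \/ I b].

Definition maximal_ideal R I : Prop :=
  [/\ is_ideal R I, I <> R
    & forall J, is_ideal R J -> I `<=` J -> J = I \/ J = R].

Definition principal_ideal R (d : T) : set T := [set a * d | a in R].

Definition ideal_quotient R I J : set T :=
  [set s | R s /\ forall u, J u -> I (s * u)].

Definition ideal_square I : set T :=
  [set x | exists n (a b : 'I_n -> T),
     (forall i, I (a i) /\ I (b i)) /\ x = \sum_i a i * b i].

End SubringTheory.

Definition has_chain (T : Type) (F : set (set T)) (n : nat) : Prop :=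
  exists c : nat -> set T,
    (forall i, (i <= n)%N -> F (c i)) /\
    (forall i, (i < n)%N -> c i `<` c i.+1).

(* The supremum of the lengths of strict chains in F is exactly n. *)
Definition chain_dim (T : Type) (F : set (set T)) (n : nat) : Prop :=
  has_chain F n /\ ~ has_chain F n.+1.

Definition krull_dim (T : comNzRingType) (R : set T) (n : nat) : Prop :=
  chain_dim (prime_ideal R) n.

(* m/m^2 has a basis with n elements over R/m. *)
Definition cotangent_dim (T : comNzRingType) (R m : set T) (n : nat) : Prop :=
  exists x : 'I_n -> T,
    [/\ forall i, m (x i),
        forall y, m y -> exists2 a : 'I_n -> T,
          forall i, R (a i) & ideal_square m (y - \sum_i a i * x i)
      & forall a : 'I_n -> T, (forall i, R (a i)) ->
          ideal_square m (\sum_i a i * x i) -> forall i, m (a i)].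

Definition regular_local_ring (T : comNzRingType) (R m : set T) : Prop :=
  exists2 n, krull_dim R n & cotangent_dim R m n.

Section IntegralClosure.
Variable K : fieldType.
Implicit Types R : set K.

Definition integral_closure R : set K :=
  [set x | exists2 p : {poly K}, forall i, R p`_i & p \is monic /\ root p x].

(* K stands for the total ring of fractions of R. *)
Definition conductor R : set K :=
  [set a | R a /\ forall b, integral_closure R b -> R (a * b)].

End IntegralClosure.

Section Localization.
Variable A : idomainType.
Implicit Types (P Q U : set A) (M B : set {fraction A}) (Sing : set (set A)).

Definition to_fraction U : set {fraction A} := [set tofrac u | u in U].

(* The localization at the prime Q of an A-submodule M of Q(A). *)
Definition localization Q M : set {fraction A} :=
  [set z | exists x s, [/\ M x, ~ Q s & z = x / tofrac s]].

Definition local_ring Q : set {fraction A} := localization Q (to_fraction setT).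

Definition local_contribution P B : Prop :=
  [/\ subring B,
      to_fraction setT `<=` B,
      B `<=` integral_closure (to_fraction setT)
    & localization P B = integral_closure (local_ring P)].

Definition minimal_local_contribution Sing P B : Prop :=
  local_contribution P B /\
  forall Q, Sing Q -> Q <> P -> localization Q B = local_ring Q.

Definition fractional_ideal (d : A) U : set {fraction A} :=
  [set tofrac u / tofrac d | u in U].

End Localization.

Section Projective.
Variables (k : fieldType) (r : nat).
Implicit Types (I J : set {mpoly k[r.+1]}).

Definition homogeneous_ideal I : Prop :=
  forall p e, I p -> I (pihomog mdeg e p).

(* The points of Proj k[X_0, ..., X_r] lying on V(I). *)
Definition proj_point I : set (set {mpoly k[r.+1]}) :=
  [set J | [/\ prime_ideal setT J, homogeneous_ideal J,
               ~ (forall i, J 'X_i) & I `<=` J]].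

(* An integral closed subscheme of P^r is given by its homogeneous prime     *)
(* ideal; its dimension is the combinatorial dimension of its set of points. *)
Record curve := Curve {
  curve_ideal : set {mpoly k[r.+1]};
  curve_prime : prime_ideal setT curve_ideal;
  curve_homogeneous : homogeneous_ideal curve_ideal;
  curve_dim : chain_dim (proj_point curve_ideal) 1;
  curve_nondegenerate : forall l, curve_ideal l -> l \is 1.-homog -> l = 0
}.

(* X_0 |-> 1 and X_(j+1) |-> x_j *)
Definition affine_coordinates : r.+1.-tuple {mpoly k[r]} :=
  [tuple if unlift ord0 i is Some j then 'X_j else 1 | i < r.+1].

Definition dehomogenize (F : {mpoly k[r.+1]}) : {mpoly k[r]} :=
  F \mPo affine_coordinates.

HB.instance Definition _ :=
  GRing.RMorphism.copy dehomogenize (@comp_mpoly _ _ _ affine_coordinates).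

Definition affine_ideal (G : curve) : {pred {mpoly k[r]}} :=
  fun f => `[< exists2 F, curve_ideal G F & dehomogenize F = f >].

Lemma affine_idealP G f :
  reflect (exists2 F, curve_ideal G F & dehomogenize F = f)
          (f \in affine_ideal G).
Proof. exact: asboolP. Qed.

Local Notation X0 := ('X_ord0 : {mpoly k[r.+1]}).

Lemma dehomogenizeX0 : dehomogenize X0 = 1.
Proof. by rewrite /dehomogenize /comp_mpoly mmapX mmap1U tnth_mktuple unlift_none. Qed.

Definition mdrop (m : 'X_{1..r.+1}) : 'X_{1..r} :=
  [multinom m (lift ord0 j) | j < r].

Lemma dehomogenizeX m : dehomogenize 'X_[m] = 'X_[mdrop m].
Proof.
rewrite /dehomogenize comp_mpolyX big_ord_recl tnth_mktuple unlift_none expr1n.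
rewrite mul1r [RHS]mpolyXE_id; apply: eq_bigr => j _.
by rewrite tnth_mktuple liftK mnmE.
Qed.

Lemma dehomogenizeE F :
  dehomogenize F = \sum_(m <- msupp F) F@_m *: 'X_[mdrop m].
Proof.
rewrite /dehomogenize comp_mpolyEX; apply: eq_bigr => m _.
by rewrite -dehomogenizeX.
Qed.

Lemma dehomogenize_eq0 e F :
  F \is e.-homog -> dehomogenize F = 0 -> F = 0.
Proof.
move=> /dhomogP homF F0; apply/mpolyP => m0; rewrite mcoeff0.
case: (boolP (m0 \in msupp F)) => [m0F|]; last by rewrite -mcoeff_eq0 => /eqP.
have := congr1 (mcoeff (mdrop m0)) F0; rewrite mcoeff0 dehomogenizeE.
rewrite raddf_sum /= (bigD1_seq m0) ?msupp_uniq //= big_seq_cond big1.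
  by rewrite addr0 mcoeffZ mcoeffX eqxx mulr1.
move=> m /andP[mF mm0]; rewrite mcoeffZ mcoeffX.
case: eqP => [eqd|]; last by rewrite mulr0.
case/eqP: mm0; apply/mnmP => i.
have dropE j : m (lift ord0 j) = m0 (lift ord0 j).
  by have := congr1 (fun m : 'X_{1..r} => m j) eqd; rewrite !mnmE.
have : mdeg m0 = mdeg m by rewrite (homF _ m0F) (homF _ mF).
rewrite !mdegE !big_ord_recl.
under eq_bigr do rewrite -dropE.
move=> /addIn eq0.
by case: (unliftP ord0 i) => [j|] ->.
Qed.

Definition homogenize (N : nat) (F : {mpoly k[r.+1]}) : {mpoly k[r.+1]} :=
  \sum_(e < N) X0 ^+ (N - e) * pihomog mdeg e F.

Lemma homog1X0 : X0 \is 1.-homog.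
Proof. by rewrite dhomogX; apply/eqP/mdeg1. Qed.

Lemma homogX0 n : X0 ^+ n \is n.-homog.
Proof.
by have := dhomogMn n homog1X0; rewrite mul1n.
Qed.

Lemma homogenize_homog N F : homogenize N F \is N.-homog.
Proof.
apply: rpred_sum => e _.
have := dhomogM (homogX0 (N - e)) (pihomogP mdeg e F).
by rewrite subnK // ltnW.
Qed.

Lemma dehomogenize_homogenize N F :
  (msize F <= N)%N -> dehomogenize (homogenize N F) = dehomogenize F.
Proof.
move=> leN; rewrite rmorph_sum /= {2}(pihomog_partitionE leN) rmorph_sum /=.
by apply: eq_bigr => e _; rewrite rmorphM rmorphXn /= dehomogenizeX0 expr1n mul1r.
Qed.

Lemma dehomogenize_surj f : exists F, dehomogenize F = f.
Proof.
exists (f \mPo [tuple 'X_(lift ord0 j) | j < r]).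
rewrite {2}[f]mpolyE comp_mpolyEX rmorph_sum /=; apply: eq_bigr => m _.
rewrite -mul_mpolyC rmorphM /= [dehomogenize _%:MP]comp_mpolyC mul_mpolyC.
congr (_ *: _); rewrite comp_mpolyX rmorph_prod /= mpolyXE_id; apply: eq_bigr.
move=> j _; rewrite rmorphXn /= tnth_mktuple dehomogenizeX; congr ('X_[_] ^+ _).
by apply/mnmP => i; rewrite !mnmE (inj_eq lift_inj).
Qed.

Section AffineIdeal.
Variable G : curve.
Local Notation I := (curve_ideal G).

Lemma curve_idealM a F : I F -> I (a * F).
Proof. by case: (curve_prime G) => -[_ _ _ IM] _ _; apply: IM. Qed.

Lemma curve_idealD F1 F2 : I F1 -> I F2 -> I (F1 + F2).
Proof. by case: (curve_prime G) => -[_ _ ID _] _ _; apply: ID. Qed.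

Lemma curve_idealX0 N F : I (X0 ^+ N * F) -> I F.
Proof.
case: (curve_prime G) => _ _ Ipr; elim: N => [|N IHN]; rewrite ?mul1r // exprS -mulrA.
case/(Ipr _ _ Logic.I Logic.I)=> // IX0.
have := congr1 dehomogenize (curve_nondegenerate IX0 homog1X0).
by rewrite dehomogenizeX0 rmorph0 => /eqP; rewrite oner_eq0.
Qed.

Lemma curve_ideal_homogenize N F : I F -> I (homogenize N F).
Proof.
move=> IF; rewrite /homogenize; elim/big_ind: _.
- by case: (curve_prime G) => -[].
- exact: curve_idealD.
- by move=> e _; apply/curve_idealM/curve_homogeneous.
Qed.

Lemma dehomogenize_affine_ideal e F : F \is e.-homog ->
  dehomogenize F \in affine_ideal G -> I F.
Proof.
move=> homF /affine_idealP[F' IF' eqF].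
pose N := (msize F' + e)%N.
have /eqP : X0 ^+ (msize F') * F - homogenize N F' = 0.
  apply: (@dehomogenize_eq0 N).
    rewrite rpredB ?homogenize_homog //; apply: dhomogM => //.
    exact: homogX0.
  rewrite rmorphB rmorphM rmorphXn /= dehomogenizeX0 expr1n mul1r.
  by rewrite dehomogenize_homogenize ?leq_addr // eqF subrr.
rewrite subr_eq0 => /eqP eqN; apply: (@curve_idealX0 (msize F')).
by rewrite eqN; apply: curve_ideal_homogenize.
Qed.

Lemma affine_ideal_closed : idealr_closed (affine_ideal G).
Proof.
split.
- apply/affine_idealP; exists 0; last exact: rmorph0.
  by case: (curve_prime G) => -[].
- apply/negP; rewrite -(rmorph1 dehomogenize) => /dehomogenize_affine_ideal.
  by move=> /(_ 0%N (dhomog1 _ _)); case: (curve_prime G).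
- move=> a f g /affine_idealP[F IF <-] /affine_idealP[F' IF' <-].
  have [b <-] := dehomogenize_surj a.
  apply/affine_idealP; exists (b * F + F'); last by rewrite rmorphD rmorphM.
  exact/curve_idealD/IF'/curve_idealM.
Qed.

Lemma affine_ideal_prime : prime_idealr_closed (affine_ideal G).
Proof.
move=> f g; have [F <-] := dehomogenize_surj f; have [F' <-] := dehomogenize_surj g.
rewrite -(dehomogenize_homogenize (leqnn (msize F))).
rewrite -(dehomogenize_homogenize (leqnn (msize F'))) -rmorphM.
move/(dehomogenize_affine_ideal (dhomogM (homogenize_homog _ _) (homogenize_homog _ _))).
case: (curve_prime G) => _ _ Ipr /(Ipr _ _ Logic.I Logic.I) IFF'.
apply/orP; case: IFF' => IF; [left|right]; apply/affine_idealP;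
  by eexists; first exact: IF.
Qed.

End AffineIdeal.

HB.instance Definition _ (G : curve) :=
  isIdealr.Build {mpoly k[r]} (affine_ideal G) (affine_ideal_closed G).
HB.instance Definition _ (G : curve) :=
  isPrimeIdealrClosed.Build {mpoly k[r]} (affine_ideal G) (@affine_ideal_prime G).

Definition coord_ring (G : curve) : Type := {ideal_quot (affine_ideal G)}.

HB.instance Definition _ (G : curve) :=
  GRing.ComNzRing.copy (coord_ring G) {ideal_quot (affine_ideal G)}.

Section CoordRing.
Variable G : curve.
Local Notation A := (coord_ring G).

(* mathcomp integral domains carry a unit predicate and an inverse; they are *)
(* provided by classical choice.                                             *)
Definition coord_unit : {pred A} := fun x => `[< exists y, y * x == 1 >].
Definition coord_inv (x : A) : A :=
  if pselect (exists y, y * x == 1) is left ex then xchoose ex else x.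

Lemma coord_mulVx : {in coord_unit, left_inverse 1 coord_inv *%R}.
Proof.
move=> x /asboolP ux; rewrite /coord_inv; case: pselect => // ex.
exact/eqP/(xchooseP ex).
Qed.

Lemma coord_unitPl (x y : A) : y * x = 1 -> coord_unit x.
Proof. by move=> /eqP yx1; apply/asboolP; exists y. Qed.

Lemma coord_inv_out : {in [predC coord_unit], coord_inv =1 id}.
Proof.
by move=> x /asboolP nux; rewrite /coord_inv; case: pselect.
Qed.

HB.instance Definition _ := GRing.ComNzRing_hasMulInverse.Build A
  coord_mulVx coord_unitPl coord_inv_out.

HB.instance Definition _ := GRing.ComUnitRing_isIntegral.Build A
  (@Quotient.rquot_IdomainAxiom _ (affine_ideal G)).

End CoordRing.

Section Points.
Variable G : curve.
Implicit Types P : set (coord_ring G).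

Definition closed_point P : Prop := maximal_ideal setT P.

(* O_(C,P) is not regular; the second argument is its maximal ideal. *)
Definition singular_point P : Prop :=
  closed_point P /\
  ~ regular_local_ring (local_ring P) (localization P (to_fraction P)).

End Points.

End Projective.

(* Main.v *)
(* The ring A = k[C] is noetherian, so the ideal quotient commutes with      *)
(* localization: (<d> : U)_Q = {z in A_Q | z B_Q <= A_Q} where B = U/d.  At  *)
(* Q = P the ring B_Q is the normalization of A_Q, which gives the conductor;*)
(* at Q <> P it remains to see that B_Q = A_Q.  This is assumed if Q is      *)
(* singular.  If Q is regular then A_Q is integrally closed: primes of A_Q   *)
(* extend to points of the projective curve, so dim A_Q <= 1, whence the     *)
(* maximal ideal is principal by Nakayama and A_Q is a field or a discrete   *)
(* valuation ring.                                                           *)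
Require Import Defs.
From mathcomp Require Import all_boot all_algebra.
From mathcomp Require Import mpoly.
From mathcomp Require Import boolp classical_sets.

Set Implicit Arguments.
Unset Strict Implicit.
Unset Printing Implicit Defensive.

Import GRing.Theory.

Local Open Scope classical_set_scope.
Local Open Scope ring_scope.

(** Put A = k[C] and B = U/d. An element s of A lies in the quotient of <d> by U exactly when sB
    lies in A. As U is finitely generated, one denominator outside Q serves all of U, and
    [localization_ideal_quotient] follows: the localized quotient consists of the z in A_Q with zB_Q
    inside A_Q. At P this is the conductor, B_P being the integral closure of A_P; elsewhere it is
    A_Q as soon as B_Q lies in A_Q.

    The work is at nonsingular Q, where B, being integral over A, lies in A_Q once A_Q is integrally
    closed. This rests on three facts. A is noetherian ([hilbert_basis], [noetherian_coord_ring]). A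
    local domain whose maximal ideal needs at most one generator is integrally closed:
    [nakayama_principal] gives the generator x, [uniformizer_factor] writes elements as unit times
    power of x, so of a/b and b/a one lies in the ring, and [integral_inv_mem] concludes. Finally
    dim A_Q <= 1 ([krull_dim_local_ring]): each prime of A_Q yields a homogeneous prime
    [cone_ideal], strict inclusions stay strict, and the projective curve has dimension 1. *)

Section Subring.
Variables (T : comNzRingType) (R : set T).
Hypothesis hR : subring R.

Lemma subring1 : R 1. Proof. by case: hR. Qed.

Lemma subringM x y : R x -> R y -> R (x * y).
Proof. by case: hR => _ _; apply. Qed.

Lemma subringB x y : R x -> R y -> R (x - y).
Proof. by case: hR => _ + _; apply. Qed.

Lemma subring0 : R 0.
Proof. by rewrite -(subrr 1); apply: subringB; apply: subring1. Qed.

Lemma subringN x : R x -> R (- x).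
Proof. by move=> Rx; rewrite -sub0r; apply: subringB => //; apply: subring0. Qed.

Lemma subringD x y : R x -> R y -> R (x + y).
Proof. by move=> Rx Ry; rewrite -[y]opprK; apply/subringB/subringN. Qed.

Lemma subringX x n : R x -> R (x ^+ n).
Proof.
move=> Rx; elim: n => [|n IHn]; first exact: subring1.
by rewrite exprS; apply: subringM.
Qed.

Lemma subring_sum n (F : 'I_n -> T) : (forall i, R (F i)) -> R (\sum_i F i).
Proof.
by move=> RF; elim/big_ind: _ => //; [apply: subring0 | apply: subringD].
Qed.

End Subring.

(** * Noetherian rings and maximal ideals *)

(* That s generates I is expressed by minimality among the ideals of R.      *)
Definition noetherian (T : comNzRingType) (R : set T) : Prop :=
  forall I, is_ideal R I -> exists2 s : seq T, (forall y, y \in s -> I y) &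
    forall J, is_ideal R J -> (forall y, y \in s -> J y) -> I `<=` J.

Lemma ideal_subr (T : comNzRingType) (R I : set T) x y :
  subring R -> is_ideal R I -> I x -> I y -> I (x - y).
Proof.
move=> hR [_ _ ID IM] Ix Iy; apply: ID => //; rewrite -mulN1r; apply: IM => //.
by apply: (subringN hR); apply: subring1.
Qed.

(** The union of the chain is an ideal, and its finitely many generators already lie in one term. *)
Lemma noetherian_chain (T : comNzRingType) (R : set T) (J : nat -> set T) :
    noetherian R -> (forall n, is_ideal R (J n)) ->
    (forall m n, (m <= n)%N -> J m `<=` J n) ->
  exists N, forall n, J n `<=` J N.
Proof.
move=> nR hJ Jle.
have hU : is_ideal R (\bigcup_n J n).
  split.
  - by move=> y [n _]; case: (hJ n) => JR _ _ _; apply: JR.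
  - by exists 0%N => //; case: (hJ 0%N).
  - move=> y z [m _ ym] [n _ zn]; exists (maxn m n) => //.
    case: (hJ (maxn m n)) => _ _ JD _.
    by apply: JD; [move: ym | move: zn]; apply: Jle; rewrite ?leq_maxl ?leq_maxr.
  - by move=> a y Ra [n _ yn]; exists n => //; case: (hJ n) => _ _ _; apply.
have [s sU sgen] := nR _ hU.
have [N sN] : exists N, forall y, y \in s -> J N y.
  elim: s sU {sgen} => [|y s IHs] sU; first by exists 0%N.
  have [N sN] : exists N, forall z, z \in s -> J N z.
    by apply: IHs => z zs; apply: sU; rewrite inE zs orbT.
  have [n _ yn] := sU y (mem_head _ _).
  exists (maxn n N) => z; rewrite inE => /predU1P[->|/sN].
    by apply: Jle yn; rewrite ?leq_maxl.
  by apply: Jle; rewrite ?leq_maxr.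
by exists N => n y yn; apply: (sgen _ (hJ N) sN); exists n.
Qed.

Lemma subring_setT (T : comNzRingType) : subring [set: T].
Proof. by []. Qed.

Lemma ideal_setI (T : comNzRingType) (R I J : set T) :
  is_ideal R I -> is_ideal R J -> is_ideal R (I `&` J).
Proof.
move=> [IR I0 ID IM] [_ J0 JD JM]; split=> //.
- by move=> x [/IR].
- by move=> x y [Ix Jx] [Iy Jy]; split; [apply: ID | apply: JD].
- by move=> a x Ra [Ix Jx]; split; [apply: IM | apply: JM].
Qed.

Lemma maximal_ideal_prime (T : comNzRingType) (I : set T) :
  maximal_ideal setT I -> prime_ideal setT I.
Proof.
move=> [hI IT Imax]; have [_ I0 ID IM] := hI.
split=> //.
  move=> I1; apply: IT; apply/seteqP; split=> // x _.
  by rewrite -[x]mulr1; apply: IM.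
move=> a b _ _ Iab; have [|nIa] := pselect (I a); [by left|right].
(* J = I + (a) is the whole ring by maximality; multiply 1 = i + ra by b. *)
pose J := [set x | exists2 i, I i & exists r, x = i + r * a].
have hJ : is_ideal setT J.
  split=> //.
  - by exists 0 => //; exists 0; rewrite mul0r addr0.
  - move=> _ _ [i Ii [r ->]] [j Ij [t ->]]; exists (i + j); first exact: ID.
    by exists (r + t); rewrite mulrDl addrACA.
  - move=> c _ _ [i Ii [r ->]]; exists (c * i); first exact: IM.
    by exists (c * r); rewrite mulrDr mulrA.
have IJ : I `<=` J by move=> x Ix; exists x => //; exists 0; rewrite mul0r addr0.
have [JI|JT] := Imax _ hJ IJ.
  by case: nIa; rewrite -JI; exists 0 => //; exists 1; rewrite mul1r add0r.
have [i Ii [r e1]] : J 1 by rewrite JT.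
rewrite -[b]mul1r e1 mulrDl; apply: ID; first by rewrite mulrC; apply: IM.
by rewrite -mulrA; apply: IM.
Qed.

Lemma noetherian_image (R S : comNzRingType) (f : {rmorphism R -> S}) :
  (forall y, exists x, f x = y) -> noetherian [set: R] -> noetherian [set: S].
Proof.
move=> fsurj nR I.
have preI J : is_ideal setT J -> is_ideal setT [set x | J (f x)].
  move=> [_ J0 JD JM]; split=> //=; first by rewrite rmorph0.
    by move=> x y Jx Jy /=; rewrite rmorphD; apply: JD.
  by move=> a x _ Jx /=; rewrite rmorphM; apply: JM.
move=> /preI /nR[s sI sgen]; exists (map f s).
  by move=> _ /mapP[x xs ->]; apply: sI.
move=> J hJ sJ y Iy; have [x fx] := fsurj y; rewrite -fx.
apply: (sgen _ (preI _ hJ)); last by rewrite /= fx.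
by move=> z zs; apply/sJ/map_f.
Qed.

Lemma noetherian_field (k : fieldType) : noetherian [set: k].
Proof.
move=> I [_ I0 _ IM]; have [[x [Ix x0]]|nI] := pselect (exists x, I x /\ x != 0).
  exists [:: x]; first by move=> y; rewrite inE => /eqP ->.
  move=> J [_ _ _ JM] sJ y _; rewrite -[y](divfK x0); apply: JM => //.
  by apply: sJ; rewrite inE.
exists [::] => // J [_ J0 _ _] _ y Iy.
by have [->//|y0] := eqVneq y 0; case: nI; exists y.
Qed.

(** * Hilbert's basis theorem *)

Section HilbertBasis.
Variable R : comNzRingType.
Implicit Types I J : set {poly R}.

(** Only a bound on the degree is required, so 0 is a member and the set is an ideal. *)
Definition lead_ideal I (n : nat) : set R :=
  [set c | exists2 q, I q & (size q <= n.+1)%N /\ q`_n = c].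

Lemma lead_ideal_ideal I n : is_ideal setT I -> is_ideal setT (lead_ideal I n).
Proof.
move=> [_ I0 ID IM]; split=> //.
- by exists 0 => //; rewrite size_poly0 coef0.
- move=> _ _ [p Ip [sp <-]] [q Iq [sq <-]]; exists (p + q); first exact: ID.
  by rewrite coefD (leq_trans (size_polyD _ _)) // geq_max sp.
- move=> a _ _ [p Ip [sp <-]]; exists (a%:P * p); first exact: IM.
  by rewrite mul_polyC coefZ (leq_trans (size_scale_leq _ _)).
Qed.

Lemma lead_idealS I m n : is_ideal setT I -> (m <= n)%N ->
  lead_ideal I m `<=` lead_ideal I n.
Proof.
move=> [_ _ _ IM] mn _ [p Ip [sp <-]]; exists ('X^(n - m) * p); first exact: IM.
rewrite coefXnM ltnNge leq_subr subKn //=; split=> //.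
have [->|p0] := eqVneq p 0; first by rewrite mulr0 size_poly0.
by rewrite mulrC size_mulXn //; rewrite -(leq_add2l (n - m)) addnS subnK in sp.
Qed.

(** Subtracting an element of J with the same top coefficient lowers the size and stays in I because
    J lies in I. *)
Lemma lead_ideal_sub I J : is_ideal setT I -> is_ideal setT J -> J `<=` I ->
  (forall n, lead_ideal I n `<=` lead_ideal J n) -> I `<=` J.
Proof.
move=> hI hJ JI lIJ q; have [n] := ubnP (size q); elim: n q => // n IHn q.
rewrite ltnS => sq Iq.
case: n => [|n] in IHn sq *.
  by move: sq; rewrite leqn0 size_poly_eq0 => /eqP ->; case: hJ.
have [|q' Jq' [sq' e]] := lIJ n q`_n; first by exists q.
have [_ _ JD _] := hJ.
rewrite -(subrK q' q); apply: JD => //; apply: IHn; last first.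
  by apply: ideal_subr (@subring_setT _) hI Iq (JI _ Jq').
rewrite ltnS; apply/leq_sizeP => j; rewrite leq_eqVlt coefB => /predU1P[<-|nj].
  by rewrite e subrr.
by rewrite !nth_default ?subrr // (leq_trans _ nj).
Qed.

(** The leading ideals stabilize at some N; polynomials realizing generators of those of index at
    most N generate I. *)
Theorem hilbert_basis : noetherian [set: R] -> noetherian [set: {poly R}].
Proof.
move=> nR I hI.
have [N stab] := noetherian_chain nR (fun n => lead_ideal_ideal n hI)
  (fun m n => @lead_idealS I m n hI).
have [s sI sN] : exists2 s : seq {poly R}, (forall y, y \in s -> I y) &
    forall J, is_ideal setT J -> (forall y, y \in s -> J y) ->
    forall n, (n < N.+1)%N -> lead_ideal I n `<=` lead_ideal J n.
  elim: N.+1 => [|M [s sI sM]]; first by exists [::].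
  have [t tL tgen] := nR _ (lead_ideal_ideal M hI).
  have /choice[f Pf] c : exists q, c \in t -> [/\ I q, (size q <= M.+1)%N & q`_M = c].
    case: (boolP (c \in t)) => [/tL[q Iq [sq e]]|_]; last by exists 0.
    by exists q.
  exists (map f t ++ s).
    move=> y; rewrite mem_cat => /orP[/mapP[c ct ->]|/sI//].
    by case: (Pf c ct).
  move=> J hJ sJ n; rewrite ltnS leq_eqVlt => /predU1P[->|]; last first.
    by apply: sM => // y ys; apply: sJ; rewrite mem_cat ys orbT.
  apply: tgen; first exact: lead_ideal_ideal.
  move=> c ct; have [_ ? ?] := Pf c ct; exists (f c) => //.
  by apply: sJ; rewrite mem_cat map_f.
exists s => // J hJ sJ.
(* [lead_ideal_sub] compares I with a smaller ideal, so J is replaced by its intersection with I. *)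
suff IIJ : I `<=` I `&` J by move=> x /IIJ[].
have hIJ := ideal_setI hI hJ.
apply: lead_ideal_sub => // n.
have {}sN := sN _ hIJ (fun y ys => conj (sI y ys) (sJ y ys)).
have [nN|Nn] := leqP n N; first exact: sN.
by apply: subset_trans (lead_idealS hIJ (ltnW Nn)); apply: subset_trans (sN _ _).
Qed.

End HilbertBasis.

Lemma noetherian_mpoly (k : fieldType) n : noetherian [set: {mpoly k[n]}].
Proof.
elim: n => [|n IHn].
  apply: (noetherian_image (f := @mpolyC 0 k)) (@noetherian_field k) => p.
  exists p@_0; apply/mpolyP => m; rewrite mcoeffC.
  have -> : m = 0%MM by apply/mnmP => -[].
  by rewrite eqxx mulr1.
(* Polynomials over k[x_0, ..., x_(n-1)] are evaluated at the last variable; this map is onto. *)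
pose f := horner_eval ('X_ord_max : {mpoly k[n.+1]}) \o map_poly (@mwiden n k).
apply: (noetherian_image (f := f)) (hilbert_basis IHn) => p.
elim/mpolyind: p => [|c m p _ _ [q fq]]; first by exists 0; rewrite rmorph0.
exists ((c *: 'X_[[multinom m (widen_ord (leqnSn n) i) | i < n]])%:P
  * 'X^(m ord_max) + q).
rewrite rmorphD -[X in _ = _ + X]fq; congr (_ + _).
rewrite /f /= /horner_eval rmorphM /= map_polyXn map_polyC /= hornerM hornerC hornerXn mwidenZ.
rewrite -scalerAl mwidenX mpolyXn -mpolyXD; congr (_ *: 'X_[_]).
apply/mnmP => i; rewrite mnmDE mulmnE mnm1E.
case: (unliftP ord_max i) => [j|] ->.
  rewrite (_ : lift _ _ = widen_ord (leqnSn n) j); last first.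
    by apply: val_inj; rewrite /= /bump leqNgt ltn_ord.
  rewrite mnmwiden_widen mnmE -[_ == _]negbK neq_ltn /=.
  by rewrite ltn_ord orbT mul0n addn0.
by rewrite mnmwiden_ordmax eqxx mul1n.
Qed.

(** * Local domains with principal maximal ideal *)

(* For p of degree n + 1, p(z) = 0 reads z = - \sum_(i <= n) p_i (1/z)^(n - i). *)
Lemma integral_inv_mem (K : fieldType) (R : set K) z : subring R ->
  integral_closure R z -> R z^-1 -> R z.
Proof.
move=> hR [p Rp [pmon /rootP pz]] Rz'.
have [->|z0] := eqVneq z 0; first exact: subring0.
case sp: (size p) => [|[|n]].
- by move: pmon; rewrite monicE lead_coefE sp => /eqP; have /eqP := sp;
    rewrite size_poly_eq0 => /eqP ->; rewrite coef0 => /esym/eqP; rewrite oner_eq0.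
- move: pz; have /eqP/size_poly1P[c c0 ->] := sp.
  by rewrite hornerC => /eqP; rewrite (negPf c0).
move: pmon pz; rewrite monicE lead_coefE sp horner_coef sp big_ord_recr /= => /eqP ->.
rewrite mul1r => /eqP; rewrite addrC addr_eq0 => /eqP e.
have -> : z = - \sum_(i < n.+1) p`_i * z^-1 ^+ (n - i).
  apply: (mulIf (expf_neq0 n z0)); rewrite -exprS e mulNr mulr_suml; congr (- _).
  apply: eq_bigr => i _; rewrite -mulrA; congr (_ * _).
  rewrite -[X in _ * z ^+ X](subnK (ltn_ord i : i <= n)%N).
  by rewrite exprD mulrA -exprMn mulVf // expr1n mul1r.
apply: (subringN hR); apply: (subring_sum hR) => i.
by apply: (subringM hR) => //; apply: subringX.
Qed.

Section LocalSubring.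
Variables (K : fieldType) (R m : set K).
Hypotheses (hR : subring R) (hm : is_ideal R m) (m1 : ~ m 1).
Hypothesis unitR : forall a, R a -> ~ m a -> R a^-1.

(* Nakayama's lemma, by removing the generators of m one by one. *)
Lemma nakayama_principal (s : seq K) x :
    (forall y, y \in s -> m y) ->
    (forall J, is_ideal R J -> (forall y, y \in s -> J y) -> m `<=` J) ->
    m x ->
    (forall y, m y -> exists2 a, R a & ideal_square m (y - a * x)) ->
  forall y, m y -> exists2 a, R a & y = a * x.
Proof.
have [mR m0 mD mM] := hm.
move=> sm sgen mx msq.
suff gen J : is_ideal R J -> J x -> m `<=` J.
  move=> y my; apply: (gen [set y | exists2 a, R a & y = a * x]) my.
    split.
    - by move=> _ [a Ra ->]; apply: subringM => //; apply: mR.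
    - by exists 0; [exact: subring0 | rewrite mul0r].
    - move=> _ _ [a Ra ->] [b Rb ->]; exists (a + b); first exact: subringD.
      by rewrite mulrDl.
    - move=> c _ Rc [a Ra ->]; exists (c * a); first exact: subringM.
      by rewrite mulrA.
  by exists 1; [exact: subring1 | rewrite mul1r].
(* The invariant of the induction: x together with the remaining s generates m. *)
have {}sgen : forall J, is_ideal R J -> J x -> (forall y, y \in s -> J y) -> m `<=` J.
  by move=> I hI _; apply: sgen.
elim: s => [|y s IHs] in sm sgen J *; first by move=> hJ Jx; apply: sgen.
move: J; apply: IHs => [z zs|]; first by apply: sm; rewrite inE zs orbT.
move=> J hJ Jx sJ; have [JR J0 JD JM] := hJ.
(* J' = J + my contains the square of m, hence m, which lies in Rx plus that square. So y = cy
   modulo J with c in m, and 1 - c is a unit. *)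
pose J' := [set z | R z /\ exists2 c, m c & J (z - c * y)].
have JJ' z : J z -> J' z.
  by move=> Jz; split; [exact: JR | exists 0; rewrite ?mul0r ?subr0].
have hJ' : is_ideal R J'.
  split.
  - by move=> z [].
  - exact: JJ'.
  - move=> z w [Rz [c mc Jc]] [Rw [e me Je]]; split; first exact: subringD.
    by exists (c + e); [exact: mD | rewrite mulrDl opprD addrACA; apply: JD].
  - move=> a z Ra [Rz [c mc Jc]]; split; first exact: subringM.
    by exists (a * c); [exact: mM | rewrite -mulrA -mulrBr; apply: JM].
have m2J' z : ideal_square m z -> J' z.
  have [_ J'0 J'D J'M] := hJ'.
  move=> [n [a [b [mab ->]]]]; elim/big_ind: _ => // i _.
  have [ma mb] := mab i.
  (* The multipliers sending a_i into J' form an ideal, so it is enough to test x, y and s. *)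
  suff /(_ _ mb)[//] : m `<=` [set c | R c /\ J' (a i * c)].
  apply: sgen.
  - split.
    + by move=> c [].
    + by split; [exact: subring0 | rewrite mulr0].
    + move=> c e [Rc Jc] [Re Je]; split; first exact: subringD.
      by rewrite mulrDr; apply: J'D.
    + move=> c e Rc [Re Je]; split; first exact: subringM.
      by rewrite mulrCA; apply: J'M.
  - by split; [exact: mR | apply: J'M; [exact: mR | exact: JJ']].
  - move=> c; rewrite inE => /predU1P[->|cs].
      have my : m y by apply: sm; rewrite mem_head.
      split; first exact: mR.
      split; first by apply: subringM => //; apply: mR.
      by exists (a i); rewrite ?subrr.
    have Jc := sJ _ cs.
    by split; [exact: JR | apply: J'M; [exact: mR | exact: JJ']].
have mJ' z : m z -> J' z.
  have [_ _ J'D J'M] := hJ'.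
  move=> /msq[a Ra /m2J' Jz]; rewrite -(subrK (a * x) z); apply: J'D => //.
  by apply: J'M => //; apply: JJ'.
have my : m y by apply: sm; rewrite mem_head.
have [_ [c mc Jc]] := mJ' _ my.
apply: (sgen _ hJ Jx) => w; rewrite inE => /predU1P[->|]; last exact: sJ.
have nm : ~ m (1 - c).
  by move=> mc'; apply: m1; rewrite -(subrK c 1); apply: mD.
have c0 : 1 - c != 0 by apply/eqP => c0; apply: nm; rewrite c0.
rewrite -[y](mulKf c0); apply: JM; last by rewrite mulrBl mul1r.
by apply: unitR => //; apply: subringB => //; [exact: subring1 | exact: mR].
Qed.

Variable x : K.
Hypothesis mx : forall y, m y -> exists2 a, R a & y = a * x.
Hypothesis xm : m x.
Hypothesis nR : noetherian R.

(** Otherwise every power of x divides a. The ideals J n of all y with y x^n in aR stabilize at some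
    N; from a = c x^(N+1) one gets c x^N = ar, so a = arx and 1 = rx lies in m. *)
Lemma uniformizer_factor a : R a -> a != 0 ->
  exists n u, [/\ R u, R u^-1 & a = u * x ^+ n].
Proof.
move=> Ra a0; apply: contrapT => na.
have [mR _ _ mM] := hm.
have Rx : R x by apply: mR.
have adiv n : exists2 c, R c & a = c * x ^+ n.
  elim: n => [|n [c Rc e]]; first by exists a; rewrite ?mulr1.
  have [mc|nmc] := pselect (m c); last by case: na; exists n, c; split=> //; apply: unitR.
  have [c' Rc' e'] := mx mc; exists c' => //.
  by rewrite e e' -mulrA -exprS.
pose J n := [set y | R y /\ exists2 r, R r & y * x ^+ n = a * r].
have hJ n : is_ideal R (J n).
  split.
  - by move=> y [].
  - split; first exact: subring0.
    by exists 0; [exact: subring0 | rewrite mul0r mulr0].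
  - move=> y z [Ry [r Rr er]] [Rz [t Rt et]]; split; first exact: subringD.
    by exists (r + t); [exact: subringD | rewrite mulrDl er et mulrDr].
  - move=> b y Rb [Ry [r Rr er]]; split; first exact: subringM.
    by exists (b * r); [exact: subringM | rewrite -mulrA er mulrCA].
have Jle n p : (n <= p)%N -> J n `<=` J p.
  move=> np y [Ry [r Rr er]]; split=> //.
  exists (r * x ^+ (p - n)); first by apply: (subringM hR) => //; exact: subringX.
  by rewrite mulrA -er -mulrA -exprD subnKC.
have [N stab] := noetherian_chain nR hJ Jle.
have [c Rc e] := adiv N.+1.
have [_ [r Rr er]] : J N c.
  apply: (stab N.+1); split=> //.
  by exists 1; [exact: subring1 | rewrite mulr1 -e].
apply: m1; have -> : 1 = r * x; last exact: mM.
apply: (mulfI a0); rewrite mulr1 mulrA -er {1}e exprS.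
by rewrite -!mulrA [x * _]mulrC.
Qed.

Lemma uniformizer_integrally_closed a b : R a -> R b ->
  integral_closure R (a / b) -> R (a / b).
Proof.
move=> Ra Rb hab; have R0 := subring0 hR.
have [->|b0] := eqVneq b 0; first by rewrite invr0 mulr0.
have [->|a0] := eqVneq a 0; first by rewrite mul0r.
have Rx : R x by case: hm => + _ _ _; apply.
have [i [u [Ru Ru' ea]]] := uniformizer_factor Ra a0.
have [j [v [Rv Rv' eb]]] := uniformizer_factor Rb b0.
have quo p q w t : (q <= p)%N -> t * x ^+ q != 0 ->
    w * x ^+ p / (t * x ^+ q) = w * t^-1 * x ^+ (p - q).
  move=> qp; rewrite mulf_eq0 => /norP[t0 x0].
  rewrite -{1}(subnK qp) exprD invfM mulrACA -!mulrA; congr (_ * _); congr (_ * _).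
  by rewrite mulrA mulfK.
(* Either a/b lies in R outright, or its inverse does and integrality applies. *)
have [ji|/ltnW ij] := leqP j i.
  rewrite ea eb quo ?eb //; last by rewrite -eb.
  by apply: (subringM hR); [apply: subringM | apply: subringX].
apply: integral_inv_mem => //; rewrite invf_div ea eb quo; last by rewrite -ea.
  by apply: (subringM hR); [apply: subringM | apply: subringX].
by [].
Qed.

End LocalSubring.

(** * The localization of a domain at a prime *)

Section LocalRing.
Variables (A : idomainType) (Q : set A).
Hypothesis hQ : prime_ideal setT Q.
Local Notation R := (local_ring Q).
Local Notation m := (localization Q (to_fraction Q)).

Lemma local_ring_frac a s : ~ Q s -> R (tofrac a / tofrac s).
Proof. by move=> Qs; exists (tofrac a), s; split=> //; exists a. Qed.

Lemma local_ringP z :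
  R z -> exists a s, [/\ ~ Q s, tofrac s != 0 & z = tofrac a / tofrac s].
Proof.
move=> [_ [s [[a _ <-] Qs ->]]]; exists a, s; split=> //.
rewrite tofrac_eq0; apply/eqP => s0; apply: Qs.
by rewrite s0; case: hQ => -[].
Qed.

Lemma tofrac_local_ring a : R (tofrac a).
Proof.
rewrite -[tofrac a]divr1 -(tofrac1 A); apply: local_ring_frac.
by case: hQ.
Qed.

Lemma prime_not_mul s t : ~ Q s -> ~ Q t -> ~ Q (s * t).
Proof. by case: hQ => _ _ /(_ s t I I) Qp Qs Qt /Qp[]. Qed.

Lemma subring_local_ring : subring R.
Proof.
split; first by rewrite -(tofrac1 A); apply: tofrac_local_ring.
- move=> _ _ /local_ringP[a [s [Qs s0 ->]]] /local_ringP[b [t [Qt t0 ->]]].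
  rewrite -mulNr addf_div // -tofracN -!tofracM -tofracD.
  by apply: local_ring_frac; apply: prime_not_mul.
- move=> _ _ /local_ringP[a [s [Qs s0 ->]]] /local_ringP[b [t [Qt t0 ->]]].
  rewrite mulf_div -!tofracM.
  by apply: local_ring_frac; apply: prime_not_mul.
Qed.

Lemma local_ring_inv s : ~ Q s -> R (tofrac s)^-1.
Proof.
by move=> Qs; rewrite -[_^-1]mul1r -(tofrac1 A); apply: local_ring_frac.
Qed.

Lemma local_maximalP z :
  m z -> exists a s, [/\ Q a, ~ Q s, tofrac s != 0 & z = tofrac a / tofrac s].
Proof.
move=> [_ [s [[a Qa <-] Qs ->]]]; exists a, s; split=> //.
rewrite tofrac_eq0; apply/eqP => s0; apply: Qs.
by rewrite s0; case: hQ => -[].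
Qed.

Lemma local_maximal_frac a s : Q a -> ~ Q s -> m (tofrac a / tofrac s).
Proof. by move=> Qa Qs; exists (tofrac a), s; split=> //; exists a. Qed.

Lemma local_maximal_ideal : is_ideal R m.
Proof.
have [[_ Q0 QD QM] Q1 _] := hQ.
split.
- by move=> _ /local_maximalP[a [s [Qa Qs _ ->]]]; apply: local_ring_frac.
- rewrite -[0](mul0r (tofrac 1)^-1) -(tofrac0 A).
  exact: local_maximal_frac.
- move=> _ _ /local_maximalP[a [s [Qa Qs s0 ->]]] /local_maximalP[b [t [Qb Qt t0 ->]]].
  rewrite addf_div // -!tofracM -tofracD.
  apply: local_maximal_frac; last exact: prime_not_mul.
  by apply: QD; rewrite 1?mulrC; apply: QM.
- move=> _ _ /local_ringP[a [s [Qs s0 ->]]] /local_maximalP[b [t [Qb Qt t0 ->]]].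
  rewrite mulf_div -!tofracM.
  by apply: local_maximal_frac; [exact: QM | exact: prime_not_mul].
Qed.

Lemma local_maximal_not1 : ~ m 1.
Proof.
move=> /local_maximalP[a [s [Qa Qs s0 /esym e]]]; apply: Qs.
move: e => /(divr1_eq); move/eqP; rewrite tofrac_eq => /eqP <-.
exact: Qa.
Qed.

Lemma local_ring_unit z : R z -> ~ m z -> R z^-1.
Proof.
move=> /local_ringP[a [s [Qs s0 ->]]] nm; rewrite invf_div.
apply: local_ring_frac => Qa; apply: nm; exact: local_maximal_frac.
Qed.

Hypothesis nA : noetherian [set: A].

(** An ideal of the local ring is generated by its contraction to A. *)
Lemma noetherian_local_ring : noetherian R.
Proof.
move=> I hI.
have preI J : is_ideal R J -> is_ideal setT [set a | J (tofrac a)].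
  move=> [_ J0 JD JM]; split=> //=.
    by move=> x y Jx Jy /=; rewrite tofracD; apply: JD.
  by move=> a x _ Jx /=; rewrite tofracM; apply: JM => //; apply: tofrac_local_ring.
have [s sI sgen] := nA (preI _ hI).
exists (map (@tofrac A) s) => [_ /mapP[x xs ->]|J hJ sJ z Iz]; first exact: sI.
have [IR _ _ IM] := hI; have [_ _ _ JM] := hJ.
have [a [t [Qt t0 e]]] := local_ringP (IR _ Iz).
rewrite e mulrC; apply: JM; first exact: local_ring_inv.
apply: (sgen _ (preI _ hJ)) => [x xs|/=]; first exact/sJ/map_f.
rewrite -(divfK t0 (tofrac a)) mulrC -e; apply: IM => //; exact: tofrac_local_ring.
Qed.

Lemma regular_integrally_closed n a b : (n < 2)%N -> cotangent_dim R m n ->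
  R a -> R b -> integral_closure R (a / b) -> R (a / b).
Proof.
move=> n2 [x [mx msq _]].
have hR := subring_local_ring; have hm := local_maximal_ideal.
have [s sm sgen] := noetherian_local_ring hm.
have [y my ysq] : exists2 y, m y &
    forall z, m z -> exists2 c, R c & ideal_square m (z - c * y).
  (* For n = 0 the generator is 0, the case of a field; for n = 1 it is the single basis element. *)
  case: n n2 x mx msq => [|[|//]] _ x mx msq.
    exists 0; first by case: hm.
    move=> z /msq[c Rc]; rewrite big_ord0 subr0 => sq.
    by exists 0; [exact: subring0 | rewrite mulr0 subr0].
  exists (x ord0) => // z /msq[c Rc]; rewrite big_ord1 => sq.
  by exists (c ord0).
have yP := nakayama_principal hR hm local_maximal_not1 local_ring_unit sm sgen my ysq.
apply: (uniformizer_integrally_closed hR hm local_maximal_not1 local_ring_unit yP my).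
exact: noetherian_local_ring.
Qed.

(* Clearing the denominators of the products z u/d takes finitely many       *)
(* generators u of U.                                                        *)
Lemma localization_ideal_quotient (U : set A) d : is_ideal setT U -> d != 0 ->
  localization Q
    (to_fraction (ideal_quotient setT (principal_ideal setT d) U))
  = [set z | R z /\
      forall b, localization Q (fractional_ideal d U) b -> R (z * b)].
Proof.
move=> hU d0; have df0 : tofrac d != 0 by rewrite tofrac_eq0.
have [_ Q1 _] := hQ.
apply/seteqP; split=> z.
  move=> [_ [t [[s [_ sU] <-] Qt ->]]]; split; first exact: local_ring_frac.
  move=> _ [_ [t' [[u Uu <-] Qt' ->]]].
  have [a _ e] := sU _ Uu.
  rewrite mulf_div mulrA -tofracM -e tofracM mulfK // -tofracM.
  by apply: local_ring_frac; apply: prime_not_mul.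
move=> [Rz zU]; have [a [t [Qt t0 ez]]] := local_ringP Rz.
(* This lets divisibility by d be checked on the generators of U only. *)
have hden T : is_ideal setT [set u | principal_ideal setT d (T * u)].
  split=> //.
  - by exists 0; rewrite ?mul0r ?mulr0.
  - move=> x y [b _ eb] [c _ ec]; exists (b + c) => //.
    by rewrite mulrDl eb ec mulrDr.
  - by move=> c x _ [b _ eb]; exists (c * b) => //; rewrite -mulrA eb mulrCA.
have [s sU sgen] := nA hU.
have [T QT sT] : exists2 T, ~ Q T &
    forall u, u \in s -> principal_ideal setT d (T * a * u).
  elim: s sU {sgen} => [|u s IHs] sU; first by exists 1.
  have [T QT sT] : exists2 T, ~ Q T &
      forall u, u \in s -> principal_ideal setT d (T * a * u).
    by apply: IHs => v vs; apply: sU; rewrite inE vs orbT.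
  have : R (z * (tofrac u / tofrac d)).
    apply: zU; exists (tofrac u / tofrac d), 1.
    rewrite tofrac1 divr1; split=> //.
    by exists u => //; apply: sU; rewrite mem_head.
  rewrite ez mulf_div => /local_ringP[b [T' [QT' T'0 /eqP]]].
  rewrite eqr_div ?mulf_neq0 // -!tofracM tofrac_eq => /eqP e.
  exists (T * T'); first exact: prime_not_mul.
  move=> v; rewrite inE => /predU1P[->|vs].
    exists (T * b * t) => //.
    by rewrite -!mulrA -e [_ * T']mulrC !mulrA.
  have [c _ ec] := sT _ vs; exists (c * T') => //.
  by rewrite mulrAC ec; rewrite -!mulrA; congr (_ * _); rewrite [RHS]mulrC !mulrA.
(* The common denominator T puts Ta in the ideal quotient, and z = Ta / (Tt). *)
exists (tofrac (T * a)), (T * t); split.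
- by exists (T * a) => //; split=> // u Uu; apply: (sgen _ (hden (T * a)) sT).
- exact: prime_not_mul.
- rewrite ez !tofracM -mulf_div divff ?mul1r // tofrac_eq0; apply/eqP => T0.
  by apply: QT; rewrite T0; case: hQ => -[].
Qed.

End LocalRing.

(** * From primes of an affine ring to homogeneous primes *)

(* Gauss: for a prime ideal I of R, the ideal I[t] of R[t] is prime. *)
Lemma prime_ideal_coef (T : comNzRingType) (R I : set T) (f g : {poly T}) :
    subring R -> prime_ideal R I -> (forall i, R f`_i) -> (forall i, R g`_i) ->
    (forall i, I (f * g)`_i) ->
  (forall i, I f`_i) \/ (forall i, I g`_i).
Proof.
move=> hR [hI _ Ip] Rf Rg Ifg; have [_ I0 ID IM] := hI.
have first_coef (h : {poly T}) : ~ (forall i, I h`_i) ->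
    exists i, ~ I h`_i /\ forall j, (j < i)%N -> I h`_j.
  move=> /existsNP[i nIi].
  have ex : exists i, `[< ~ I h`_i >] by exists i; apply/asboolP.
  exists (ex_minn ex); case: ex_minnP => j /asboolP nIj jmin; split=> // l lj.
  by apply: contrapT => nIl; move: lj; rewrite ltnNge jmin //; apply/asboolP.
(* With i, j the first indices of coefficients outside I, the coefficient of fg at i + j is f_i g_j
   modulo I. *)
apply: contrapT => /not_orP[/first_coef[i [nfi fi]] /first_coef[j [ngj gj]]].
have ij : (i < (i + j).+1)%N by rewrite ltnS leq_addr.
have := Ifg (i + j)%N; rewrite coefM (bigD1 (Ordinal ij)) //= addKn => Isum.
have Irest : I (\sum_(l < (i + j).+1 | l != Ordinal ij) f`_l * g`_(i + j - l)).
  elim/big_ind: _ => // l; rewrite -val_eqE /= neq_ltn => /orP[li|il].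
    by rewrite mulrC; apply: IM => //; apply: fi.
  apply: IM => //; apply: gj.
  by rewrite ltn_subLR ?ltn_add2r // -ltnS.
have /(Ip _ _ (Rf i) (Rg j))[] // : I (f`_i * g`_j).
by rewrite -(addrK (\sum_(l < (i + j).+1 | l != Ordinal ij) f`_l * g`_(i + j - l))
  (f`_i * g`_j)); apply: ideal_subr hR hI _ Irest.
Qed.

Section AffineCone.
Variables (k : fieldType) (r : nat) (K : comNzRingType).
Variable phi : {rmorphism {mpoly k[r]} -> K}.

(* X_i |-> phi(x_i) t with x_0 = 1: the affine cone, away from X_0 = 0, over *)
(* the affine scheme given by phi.                                           *)
Definition cone_map : {rmorphism {mpoly k[r.+1]} -> {poly K}} :=
  mmap (polyC \o phi \o @mpolyC r k)
       (fun i => (phi (tnth (affine_coordinates k r) i))%:P * 'X).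

Lemma cone_mapX m : cone_map 'X_[m] = (phi (dehomogenize 'X_[m]))%:P * 'X^(mdeg m).
Proof.
rewrite /= mmapX /mmap1 /dehomogenize comp_mpolyX mdegE -prodrXr.
rewrite !rmorph_prod -big_split /=.
by apply: eq_bigr => i _; rewrite exprMn !rmorphXn.
Qed.

Lemma cone_mapZ c F : cone_map (c *: F) = (phi c%:MP)%:P * cone_map F.
Proof. exact: mmapZ. Qed.

(** The exponent of t records the degree, so coefficients separate homogeneous components. *)
Lemma coef_cone_map F e :
  (cone_map F)`_e = phi (dehomogenize (pihomog mdeg e F)).
Proof.
elim/mpolyind: F => [|c m q _ _ IHq]; first by rewrite pihomog0 !rmorph0 coef0.
rewrite pihomogD !rmorphD coefD IHq; congr (_ + _).
rewrite cone_mapZ cone_mapX linearZ /= pihomogX mulrA -rmorphM coefCM coefXn eq_sym.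
case: eqP => _; last by rewrite mulr0 scaler0 !rmorph0.
by rewrite mulr1 -!mul_mpolyC !rmorphM /= [dehomogenize _%:MP]comp_mpolyC.
Qed.

Lemma cone_map_homog F e : F \is e.-homog ->
  cone_map F = phi (dehomogenize F) *: 'X^e.
Proof.
move=> homF; apply/polyP => i; rewrite coef_cone_map coefZ coefXn.
have [->|ie] := eqVneq i e; first by rewrite pihomog_dE // mulr1.
by rewrite (pihomog_ne0 _ homF) ?rmorph0 ?mulr0 // eq_sym.
Qed.

Lemma cone_mapX0 : cone_map 'X_ord0 = 'X.
Proof.
by rewrite (cone_map_homog (homog1X0 _ _)) dehomogenizeX0 rmorph1 scale1r expr1.
Qed.

(** The preimage of I[t]; for a prime I it is the homogeneous ideal of the closure in projective
    space of the point given by I. *)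
Definition cone_ideal (I : set K) : set {mpoly k[r.+1]} :=
  [set F | forall i, I (cone_map F)`_i].

Lemma cone_ideal_prime (R I : set K) : subring R -> (forall f, R (phi f)) ->
  prime_ideal R I -> prime_ideal setT (cone_ideal I).
Proof.
move=> hR phiR hI; have [[_ I0 ID IM] I1 _] := hI.
have coneR F i : R (cone_map F)`_i by rewrite coef_cone_map.
split.
- split=> //.
  + by move=> i; rewrite rmorph0 coef0.
  + by move=> F H JF JH i; rewrite rmorphD coefD; apply: ID.
  + move=> F H _ JH i; rewrite rmorphM coefM; elim/big_ind: _ => // j _.
    exact: IM.
- by move=> /(_ 0%N); rewrite rmorph1 coef1.
- move=> F H _ _ JFH; apply: (prime_ideal_coef hR hI) => // i.
  by rewrite -rmorphM.
Qed.

Lemma cone_ideal_homogeneous (R I : set K) : is_ideal R I ->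
  homogeneous_ideal (cone_ideal I).
Proof.
move=> [_ I0 _ _] F e JF i; rewrite (cone_map_homog (pihomogP _ _ _)).
by rewrite -coef_cone_map coefZ coefXn; case: eqP => _; rewrite ?mulr1 ?mulr0.
Qed.

Lemma homogenize_cone_ideal (R I : set K) F : is_ideal R I ->
  cone_ideal I (homogenize (msize F) F) <-> I (phi (dehomogenize F)).
Proof.
move=> [_ I0 _ _].
have HE : cone_map (homogenize (msize F) F)
    = phi (dehomogenize F) *: 'X^(msize F).
  by rewrite (cone_map_homog (homogenize_homog _ _)) dehomogenize_homogenize.
split=> [/(_ (msize F))|IF i]; rewrite HE coefZ coefXn.
  by rewrite eqxx mulr1.
by case: eqP => _; rewrite ?mulr1 ?mulr0.
Qed.

End AffineCone.

(** * Local rings of the curve and their dimension *)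

Section LocalRingOfCurve.
Variables (k : fieldType) (r : nat) (G : curve k r).
Local Notation A := (coord_ring G).
Local Notation K := {fraction A}.

Definition coord_proj : {rmorphism {mpoly k[r]} -> A} :=
  \pi_{ideal_quot (affine_ideal G)}%qT.

Lemma coord_proj_surj x : exists f, coord_proj f = x.
Proof. by exists (repr x); apply: reprK. Qed.

Lemma coord_proj_eq0 f : f \in affine_ideal G -> coord_proj f = 0.
Proof.
move=> If; rewrite -(rmorph0 coord_proj); apply/eqP.
by rewrite -[_ == _]Quotient.idealrBE subr0.
Qed.

Lemma noetherian_coord_ring : noetherian [set: A].
Proof. exact: noetherian_image coord_proj_surj (@noetherian_mpoly k r). Qed.

Definition coord_frac : {rmorphism {mpoly k[r]} -> K} := @tofrac A \o coord_proj.

Lemma coord_frac_surj a : exists f, coord_frac f = tofrac a.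
Proof. by have [f <-] := coord_proj_surj a; exists f. Qed.

Lemma coord_frac_eq0 f : f \in affine_ideal G -> coord_frac f = 0.
Proof. by move=> /coord_proj_eq0 f0; rewrite -(tofrac0 A) -f0. Qed.

Variable Q : set A.
Hypothesis hQ : prime_ideal setT Q.
Local Notation R := (local_ring Q).

Lemma cone_ideal_proj_point I : prime_ideal R I ->
  proj_point (curve_ideal G) (cone_ideal coord_frac I).
Proof.
move=> hI; have [hI' I1 _] := hI; have [_ I0 _ _] := hI'.
have hR := subring_local_ring hQ.
split.
- by apply: (cone_ideal_prime hR _ hI) => f; apply: (tofrac_local_ring hQ).
- exact: cone_ideal_homogeneous hI'.
(* X_0 maps to t, whose coefficient 1 is not in I. *)
- by move=> /(_ ord0 1%N); rewrite cone_mapX0 coefX.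
- move=> F IF i; rewrite coef_cone_map coord_frac_eq0 //.
  apply/affine_idealP.
  by exists (pihomog mdeg i F) => //; apply: curve_homogeneous.
Qed.

(** An ideal of R is determined by the numerators it contains, and each numerator is the
    dehomogenization of a form, on which the cone ideal detects membership. *)
Lemma cone_ideal_proper I J : prime_ideal R I -> prime_ideal R J ->
  I `<` J -> cone_ideal coord_frac I `<` cone_ideal coord_frac J.
Proof.
move=> [hI _ _] [hJ _ _] [IJ nJI]; split.
  by move=> F JF i; apply: IJ.
have [_ _ _ IM] := hI; have [JR _ _ JM] := hJ.
move=> JI; apply: nJI => z Jz.
have [a [s [Qs s0 ez]]] := local_ringP hQ (JR _ Jz).
have [f fa] := coord_frac_surj a; have [F Ff] := dehomogenize_surj f.
have Ja : J (tofrac a).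
  rewrite -(divfK s0 (tofrac a)) -ez mulrC; apply: JM => //.
  exact: tofrac_local_ring.
rewrite ez mulrC; apply: IM; first exact: local_ring_inv.
rewrite -fa -Ff; apply/(homogenize_cone_ideal coord_frac F hI)/JI.
by apply/(homogenize_cone_ideal coord_frac F hJ); rewrite Ff fa.
Qed.

Lemma krull_dim_local_ring n : krull_dim R n -> (n < 2)%N.
Proof.
move=> [[c [cP cS]] _]; rewrite ltnNge; apply/negP => n2.
case: (curve_dim G) => _; apply; exists (fun i => cone_ideal coord_frac (c i)); split=> i i2.
  by apply/cone_ideal_proj_point/cP/(leq_trans i2).
have ni := leq_trans i2 n2.
by apply: cone_ideal_proper; [apply/cP/ltnW | apply: cP | apply: cS].
Qed.

End LocalRingOfCurve.

Theorem proposition6p1 (k : fieldType) (hk : perfect_field k) (r : nat)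
    (G : curve k r) (P : set (coord_ring G)) (hP : singular_point P)
    (U : set (coord_ring G)) (d : coord_ring G)
    (hU : is_ideal setT U) (hdU : U d) (hd : d != 0)
    (hmin : minimal_local_contribution (@singular_point k r G) P
              (fractional_ideal d U)) :
  forall Q : set (coord_ring G), closed_point Q ->
    (Q = P ->
       localization Q
         (to_fraction (ideal_quotient setT (principal_ideal setT d) U))
       = conductor (local_ring Q)) /\
    (Q <> P ->
       localization Q
         (to_fraction (ideal_quotient setT (principal_ideal setT d) U))
       = local_ring Q).
Proof.
move=> Q cQ; have hQ := maximal_ideal_prime cQ.
have nA := @noetherian_coord_ring k r G.
rewrite (localization_ideal_quotient hQ nA hU hd).
case: hmin => -[_ _ Bint BP] BQ.
(* At P, B_P is the integral closure, so the set is literally the conductor. *)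
split=> [QP|QP]; first by rewrite QP BP.
suff BR : localization Q (fractional_ideal d U) `<=` local_ring Q.
  apply/seteqP; split=> [z []//|z Rz]; split=> // b /BR.
  exact: (subringM (subring_local_ring hQ)).
have [sQ|nsQ] := pselect (singular_point Q); first by rewrite BQ.
have [n dimn cotn] : regular_local_ring (local_ring Q)
    (localization Q (to_fraction Q)).
  by apply: contrapT => nreg; apply: nsQ; split.
move=> _ [_ [t [[u Uu <-] Qt ->]]].
apply: (subringM (subring_local_ring hQ)); last exact: local_ring_inv.
apply: (regular_integrally_closed hQ nA (krull_dim_local_ring hQ dimn) cotn);
  try exact: tofrac_local_ring.
(* u/d is integral over A, hence over A_Q by the same monic equation. *)
have [p Ap pz] : integral_closure (to_fraction setT) (tofrac u / tofrac d).
  by apply: Bint; exists u.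
exists p => // i; have [a _ <-] := Ap i; exact: tofrac_local_ring.
Qed.
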